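(* Fix $q,\beta\in[1,\infty)$ and let $(X,d_X)$ be a $q$-barycentric metric space with constant $\beta$. Then for every $n\in\mathbb{N}$ and every even $m\in 2\mathbb{N}$, every function $f:\mathbb{Z}_{2m}^n\to X$ satisfies $$\Big(\sum_{i=1}^n\sum_{x\in\mathbb{Z}_{2m}^n} d_X\big(f(x+me_i),f(x)\big)^q\Big)^{1/q}\le \big(4n^{1/q}+\beta m\big)\Big(\frac{1}{2^n}\sum_{\varepsilon\in\{-1,1\}^n}\sum_{x\in\mathbb{Z}_{2m}^n} d_X\big(f(x+\varepsilon),f(x)\big)^q\Big)^{1/q}.$$ In particular, if $m\ge \beta^{-1}n^{1/q}$, then the left-hand side is at most $5\beta m$ times the bracketed average on the right (i.e. the metric cotype $q$ inequality holds with constant $\Gamma\le 5\beta$).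
   Context: $\mathbb{Z}_{2m}=\mathbb{Z}/(2m\mathbb{Z})$, additions in arguments of $f$ are modulo $2m$, $e_1,\dots,e_n$ is the standard basis of $\mathbb{Z}_{2m}^n$, and $\varepsilon\in\{-1,1\}^n$ is regarded as an element of $\mathbb{Z}_{2m}^n$. For a set $\Omega$, $\mathscr{P}^{<\infty}_\Omega$ denotes the finitely supported probability measures on $\Omega$; a barycenter map is $\mathfrak{B}:\mathscr{P}^{<\infty}_\Omega\to\Omega$ with $\mathfrak{B}(\delta_x)=x$. For $q\in[1,\infty)$, $\beta>0$, a metric space $(X,d_X)$ is $q$-barycentric with constant $\beta$ if there is a barycenter map $\mathfrak{B}:\mathscr{P}^{<\infty}_X\to X$ with $d_X(\mathfrak{B}(\mu),x)^q+\beta^{-q}\int_X d_X(\mathfrak{B}(\mu),y)^q\,d\mu(y)\le\int_X d_X(x,y)^q\,d\mu(y)$ for all $x\in X$, $\mu\in\mathscr{P}^{<\infty}_X$. *)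

(* Defs.v *)
From Stdlib Require Import Reals List.
From mathcomp Require Import all_boot all_order all_algebra.
Set Implicit Arguments. Unset Strict Implicit. Unset Printing Implicit Defensive.

Section Grid.
Local Open Scope ring_scope.
Variable m n : nat.

Definition ebasis (i : 'I_n) : 'rV['Z_(2 * m)]_n := delta_mx 0 i.

Definition shift_me (x : 'rV['Z_(2 * m)]_n) (i : 'I_n) : 'rV['Z_(2 * m)]_n :=
  x + (ebasis i) *+ m.

Definition eps_vec (e : {ffun 'I_n -> bool}) : 'rV['Z_(2 * m)]_n :=
  \row_j (if e j then 1 else -1).

Definition shift_eps (x : 'rV['Z_(2 * m)]_n) (e : {ffun 'I_n -> bool}) :
  'rV['Z_(2 * m)]_n := x + eps_vec e.
End Grid.

Open Scope R_scope.

(* ---------- real powers t^p for t >= 0 (with 0^p = 0, p > 0) ---------- *)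
Definition rpow (t p : R) : R := if Req_EM_T t 0 then 0 else Rpower t p.

Notation "\rsum_ ( x : T ) F" := (\big[Rplus/0]_(x : T) F)
  (at level 41, F at level 41, x, T at level 50).

Definition is_metric (X : Type) (d : X -> X -> R) : Prop :=
  (forall x y, 0 <= d x y) /\
  (forall x y, d x y = 0 <-> x = y) /\
  (forall x y, d x y = d y x) /\
  (forall x y z, d x z <= d x y + d y z).

(* ---------- finitely supported probability measures ----------
   A finitely supported probability measure on X is a weight function
   w : X -> R that is nonnegative, vanishes outside some finite duplicate-free
   list s, and has total mass 1 on s. *)
Definition fs_prob (X : Type) (w : X -> R) (s : list X) : Prop :=
  NoDup s /\ (forall y, ~ In y s -> w y = 0) /\ (forall y, 0 <= w y) /\
  fold_right (fun y acc => w y + acc) 0 s = 1.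

Definition integ (X : Type) (w : X -> R) (s : list X) (g : X -> R) : R :=
  fold_right (fun y acc => w y * g y + acc) 0 s.

Definition q_barycentric (X : Type) (d : X -> X -> R) (q beta : R) : Prop :=
  exists B : (X -> R) -> X,
    (forall (x : X) (w : X -> R),
        w x = 1 -> (forall y, y <> x -> w y = 0) -> B w = x) /\
    (forall (w : X -> R) (s : list X) (x : X), fs_prob w s ->
        rpow (d (B w) x) q
        + / rpow beta q * integ w s (fun y => rpow (d (B w) y) q)
        <= integ w s (fun y => rpow (d x y) q)).

Definition cotype_lhs (X : Type) (d : X -> X -> R) (q : R) (m n : nat)
    (f : 'rV['Z_(2 * m)]_n -> X) : R :=
  \rsum_(i : 'I_n) \rsum_(x : 'rV['Z_(2 * m)]_n)
      rpow (d (f (shift_me x i)) (f x)) q.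

Definition cotype_rhs (X : Type) (d : X -> X -> R) (q : R) (m n : nat)
    (f : 'rV['Z_(2 * m)]_n -> X) : R :=
  / 2 ^ n * \rsum_(e : {ffun 'I_n -> bool}) \rsum_(x : 'rV['Z_(2 * m)]_n)
      rpow (d (f (shift_eps x e)) (f x)) q.

(* Main.v *)
(** Starting from [h_0 = f], average one coordinate at a time with barycenters of
    two-point measures: [h_{k+1}(x) = B(h_k(x + e_k), h_k(x - e_k))].  For a sign
    vector [s] let [t_k] be its part supported on the coordinates [j >= k], and put
    [P_k = sum_{s,x} d(h_k(x + t_k), f(x))^q].  The barycentric inequality says
    that [P_k] decreases by at least [beta^-q] times the [q]-th moment of
    the increments [d(h_{k+1}(x), h_k(x +- e_k))].  Hence the sum over [k] of the
    increments is controlled by [P_0], which is the right-hand side, and so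
    is each [P_k].  The path
      [f(x + m e_k)  ->  h_k(x + m e_k + t_k)  ->  h_k(x + t_k)  ->  f(x)]
    together with Minkowski's inequality gives the theorem: the outer steps cost
    [P_k], and the middle one consists of [m / 2] translations by [2 e_k], each of
    them the sum of two increments. *)
Require Import Defs.
From Stdlib Require Import Reals List Lra Classical ClassicalEpsilon.
From HB Require Import structures.
From mathcomp Require Import all_boot all_order all_algebra.
Open Scope R_scope.

(** * Real addition and multiplication as laws for iterated sums *)

HB.instance Definition _ := Monoid.isComLaw.Build R 0 Rplus
  (fun x y z => esym (Rplus_assoc x y z)) Rplus_comm Rplus_0_l.
HB.instance Definition _ := Monoid.isMulLaw.Build R 0 Rmult Rmult_0_l Rmult_0_r.
HB.instance Definition _ := Monoid.isAddLaw.Build R Rmult Rplus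
  Rmult_plus_distr_r Rmult_plus_distr_l.

(** * Real powers of nonnegative numbers *)

Lemma rpow0 p : rpow 0 p = 0.
Proof. by rewrite /rpow; case: Req_EM_T. Qed.

Lemma rpow_pos t p : 0 < t -> rpow t p = Rpower t p.
Proof. by rewrite /rpow; case: Req_EM_T => //= t0 ?; lra. Qed.

Lemma rpow_gt0 t p : 0 < t -> 0 < rpow t p.
Proof. by move=> t0; rewrite rpow_pos //; apply: exp_pos. Qed.

Lemma rpow_ge0 t p : 0 <= rpow t p.
Proof.
rewrite /rpow; case: Req_EM_T => /= _; first exact: Rle_refl.
exact/Rlt_le/exp_pos.
Qed.

Lemma rpowM t u p : 0 <= t -> 0 <= u -> rpow (t * u) p = rpow t p * rpow u p.
Proof.
move=> [t0|<-]; last by rewrite Rmult_0_l rpow0 Rmult_0_l.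
move=> [u0|<-]; last by rewrite Rmult_0_r rpow0 Rmult_0_r.
by rewrite !rpow_pos //; [rewrite Rpower_mult_distr | exact: Rmult_lt_0_compat].
Qed.

Lemma rpow_le t u p : 0 <= p -> 0 <= t -> t <= u -> rpow t p <= rpow u p.
Proof.
move=> p0 [t0|<-] tu; last by rewrite rpow0; apply: rpow_ge0.
rewrite !rpow_pos //; last exact: (Rlt_le_trans _ _ _ t0 tu).
exact: Rle_Rpower_l.
Qed.

Lemma rpow_root t p : p <> 0 -> 0 <= t -> rpow (rpow t (/ p)) p = t.
Proof.
move=> p0 [t0|<-]; last by rewrite !rpow0.
rewrite rpow_pos; last exact: rpow_gt0.
by rewrite rpow_pos // Rpower_mult Rinv_l // Rpower_1.
Qed.

Lemma root_rpow t p : p <> 0 -> 0 <= t -> rpow (rpow t p) (/ p) = t.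
Proof.
move=> p0 t0; rewrite -{1}(Rinv_inv p) rpow_root //.
exact: Rinv_neq_0_compat.
Qed.

Lemma ln_le_pred x : 0 < x -> ln x <= x - 1.
Proof. by move=> x0; have := exp_ineq1_le (ln x); rewrite exp_ln //; lra. Qed.

(** The tangent line of the power at [1], from which convexity follows below. *)
Lemma rpow_bernoulli x q : 1 <= q -> 0 <= x -> 1 + q * (x - 1) <= rpow x q.
Proof.
move=> q1 [x0|<-]; last by rewrite rpow0; lra.
case: (Rle_or_lt (1 + q * (x - 1)) 0) => [zle0|z0].
  exact: (Rle_trans _ _ _ zle0 (rpow_ge0 _ _)).
set z := 1 + q * (x - 1) in z0 *.
rewrite rpow_pos // -(exp_ln z) //.
(* Concavity of [ln] at [x], a convex combination of [1] and [z]. *)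
have xi0 : 0 < / x by exact: Rinv_0_lt_compat.
have l1 := ln_le_pred _ xi0.
have l2 := ln_le_pred _ (Rmult_lt_0_compat _ _ z0 xi0).
rewrite (ln_mult _ _ z0 xi0) in l2.
rewrite (ln_Rinv _ x0) in l1 l2.
have zE : z * / x = q + (1 - q) * / x by rewrite /z; field; lra.
have h : (q - 1) * (- ln x) <= (q - 1) * (/ x - 1).
  by apply: Rmult_le_compat_l => //; lra.
have [lt|->] : ln z <= q * ln x by lra.
  exact/Rlt_le/exp_increasing.
exact: Rle_refl.
Qed.

(** The tangent-line bound is applied to [u / z] and [v / z], where [z] is the weighted mean; these
    ratios average to [1], so the linear terms cancel. *)
Lemma rpow_convex q l u v : 1 <= q -> 0 <= l <= 1 -> 0 <= u -> 0 <= v ->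
  rpow (l * u + (1 - l) * v) q <= l * rpow u q + (1 - l) * rpow v q.
Proof.
move=> q1 l01 u0 v0.
have lu : 0 <= l * u by apply: Rmult_le_pos; lra.
have lv : 0 <= (1 - l) * v by apply: Rmult_le_pos; lra.
have lU : 0 <= l * rpow u q by apply: Rmult_le_pos; [lra|exact: rpow_ge0].
have lV : 0 <= (1 - l) * rpow v q by apply: Rmult_le_pos; [lra|exact: rpow_ge0].
set z := l * u + _.
have [z0|z0] : 0 <= z by rewrite /z; lra.
  have bound w : 0 <= w -> (1 + q * (w / z - 1)) * rpow z q <= rpow w q.
    move=> w0.
    have wz : 0 <= w / z by apply: Rmult_le_pos => //; exact/Rlt_le/Rinv_0_lt_compat.
    have -> : rpow w q = rpow (w / z) q * rpow z q.
      by rewrite -rpowM //; [congr rpow; field; lra | lra].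
    by apply: Rmult_le_compat_r; [exact: rpow_ge0 | exact: rpow_bernoulli].
  have bu : l * ((1 + q * (u / z - 1)) * rpow z q) <= l * rpow u q.
    by apply: Rmult_le_compat_l; [lra | exact: bound].
  have bv : (1 - l) * ((1 + q * (v / z - 1)) * rpow z q) <= (1 - l) * rpow v q.
    by apply: Rmult_le_compat_l; [lra | exact: bound].
  have e : l * ((1 + q * (u / z - 1)) * rpow z q)
    + (1 - l) * ((1 + q * (v / z - 1)) * rpow z q) = rpow z q.
    have lE : l * (u / z) + (1 - l) * (v / z) = 1.
      transitivity ((l * u + (1 - l) * v) / z); first by field; lra.
      by rewrite -/z; field; lra.
    transitivity (rpow z q * (1 + q * (l * (u / z) + (1 - l) * (v / z) - 1))).
      by ring.
    by rewrite lE; ring.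
  lra.
by rewrite -z0 rpow0; lra.
Qed.

(** * Finite real sums and Minkowski's inequality *)

Section RealSums.
Variable I : finType.
Implicit Types (F G : I -> R) (c : R).

Lemma rsumD F G : \rsum_(i : I) (F i + G i) = \rsum_(i : I) F i + \rsum_(i : I) G i.
Proof. exact: big_split. Qed.

Lemma rsumM c F : \rsum_(i : I) (c * F i) = c * \rsum_(i : I) F i.
Proof. by rewrite big_distrr. Qed.

Lemma rsum_const c : \rsum_(i : I) c = INR #|I| * c.
Proof.
rewrite big_const; elim: #|I| => [|k IH]; first by rewrite /=; lra.
by rewrite iterS IH S_INR; lra.
Qed.

Lemma rsum_le F G : (forall i, F i <= G i) ->
  \rsum_(i : I) F i <= \rsum_(i : I) G i.
Proof.
move=> le; apply: (big_ind2 Rle) => //; first exact: Rle_refl.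
by move=> *; apply: Rplus_le_compat.
Qed.

Lemma rsum_ge0 F : (forall i, 0 <= F i) -> 0 <= \rsum_(i : I) F i.
Proof.
move=> F0; apply: (big_ind (Rle 0)) => //; first exact: Rle_refl.
by move=> *; apply: Rplus_le_le_0_compat.
Qed.

Lemma le_rsum F i : (forall j, 0 <= F j) -> F i <= \rsum_(j : I) F j.
Proof.
move=> F0; rewrite (bigD1 i) //=.
suff : 0 <= \big[Rplus/0]_(j | j != i) F j by lra.
apply: (big_ind (Rle 0)) => //; first exact: Rle_refl.
by move=> *; apply: Rplus_le_le_0_compat.
Qed.

Lemma rsum_rpow_le0 q F : (forall i, 0 <= F i) ->
  \rsum_(i : I) rpow (F i) q <= 0 -> forall i, F i = 0.
Proof.
move=> F0 le0 i; case: (F0 i) => // Fi.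
have := rpow_gt0 _ q Fi.
have := le_rsum (fun j => rpow (F j) q) i (fun j => rpow_ge0 _ _); lra.
Qed.

(** Norm bounds are phrased as sums of [q]-th powers bounded by [rpow A q], so that estimates chain
    without taking roots. *)
Lemma minkowski q (a b c : I -> R) A B : 1 <= q -> 0 <= A -> 0 <= B ->
  (forall i, 0 <= a i) -> (forall i, 0 <= b i) ->
  (forall i, 0 <= c i <= a i + b i) ->
  \rsum_(i : I) rpow (a i) q <= rpow A q ->
  \rsum_(i : I) rpow (b i) q <= rpow B q ->
  \rsum_(i : I) rpow (c i) q <= rpow (A + B) q.
Proof.
move=> q1 A0 B0 a0 b0 cab aA bB.
apply: (Rle_trans _ (\rsum_(i : I) rpow (a i + b i) q)).
  by apply: rsum_le => i; have [] := cab i; apply: rpow_le; lra.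
(* A zero bound forces its family to vanish; these cases go first because the main case divides by
   [A] and [B]. *)
case: A0 aA => [A0|<-] aA; last first.
  rewrite rpow0 in aA; rewrite Rplus_0_l.
  under eq_bigr => i _ do rewrite (rsum_rpow_le0 _ _ a0 aA i) Rplus_0_l.
  exact: bB.
case: B0 bB => [B0|<-] bB; last first.
  rewrite rpow0 in bB; rewrite Rplus_0_r.
  under eq_bigr => i _ do rewrite (rsum_rpow_le0 _ _ b0 bB i) Rplus_0_r.
  exact: aA.
have AB0 : 0 < A + B by lra.
have ABi := Rinv_0_lt_compat _ AB0.
have Ai := Rinv_0_lt_compat _ A0; have Bi := Rinv_0_lt_compat _ B0.
(* With this weight, [a i + b i] is [A + B] times a convex combination of [a i / A] and [b i / B],
   families of [q]-norm at most [1]. *)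
set l := A / (A + B).
have l0 : 0 < l by exact: Rmult_lt_0_compat.
have l1E : 1 - l = B / (A + B) by rewrite /l; field; lra.
have l1 : 0 < 1 - l by rewrite l1E; exact: Rmult_lt_0_compat.
have pw i : rpow (a i + b i) q <=
    rpow (A + B) q * (l * rpow (/ A) q * rpow (a i) q
                      + (1 - l) * rpow (/ B) q * rpow (b i) q).
  have aAi : 0 <= / A * a i by apply: Rmult_le_pos => //; lra.
  have bBi : 0 <= / B * b i by apply: Rmult_le_pos => //; lra.
  have -> : a i + b i = (A + B) * (l * (/ A * a i) + (1 - l) * (/ B * b i)).
    by rewrite l1E /l; field; lra.
  rewrite rpowM; [|lra|]; last first.
    by apply: Rplus_le_le_0_compat; apply: Rmult_le_pos => //; lra.
  apply: Rmult_le_compat_l; first exact: rpow_ge0.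
  rewrite !(Rmult_assoc _ (rpow _ _)) -(rpowM (/ A)) -?(rpowM (/ B)) //; try lra.
  by apply: rpow_convex => //; lra.
apply: Rle_trans (rsum_le _ _ pw) _.
rewrite rsumM rsumD !rsumM.
have inv t : 0 < t -> rpow (/ t) q * rpow t q = 1.
  move=> t0; have ti := Rinv_0_lt_compat _ t0.
  rewrite -rpowM; [|lra|lra].
  rewrite Rinv_l; last lra.
  rewrite rpow_pos; last lra.
  by rewrite /Rpower ln_1 Rmult_0_r exp_0.
rewrite -{2}(Rmult_1_r (rpow (A + B) q)).
apply: Rmult_le_compat_l; first exact: rpow_ge0.
apply: (Rle_trans _ ( l * rpow (/ A) q * rpow A q + (1 - l) * rpow (/ B) q * rpow B q));
  last by rewrite !(Rmult_assoc _ (rpow _ _)) !inv //; lra.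
by apply: Rplus_le_compat; apply: Rmult_le_compat_l => //;
  apply: Rmult_le_pos; try lra; exact: rpow_ge0.
Qed.
End RealSums.

(** * Translation invariance and two-point barycenters *)

Lemma rsum_shift (V : finZmodType) (v : V) (F : V -> R) :
  \rsum_(x : V) F (x + v)%R = \rsum_(x : V) F x.
Proof. by rewrite [RHS](reindex_inj (GRing.addIr v)). Qed.

(** [mid a b] is the barycenter of the mean of the Dirac masses at [a] and [b]; the bound is the
    barycentric inequality for that measure. *)
Lemma midpoint_map (X : Type) (d : X -> X -> R) q beta :
  q_barycentric d q beta ->
  exists mid : X -> X -> X, forall a b x,
    rpow (d (mid a b) x) q + / rpow beta q *
      ((rpow (d (mid a b) a) q + rpow (d (mid a b) b) q) / 2)
    <= (rpow (d x a) q + rpow (d x b) q) / 2.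
Proof.
move=> [B [_ HB]].
(* Half a Dirac mass, so that [delta a + delta b] has total mass [1] even if [a = b]. *)
pose delta (a y : X) := if excluded_middle_informative (y = a) then / 2 else 0.
have dE a : delta a a = / 2 by rewrite /delta; case: excluded_middle_informative.
have dN a y : y <> a -> delta a y = 0.
  by rewrite /delta; case: excluded_middle_informative.
have d0 a y : 0 <= delta a y.
  by rewrite /delta; case: excluded_middle_informative => /= _; lra.
pose w a b y := delta a y + delta b y.
have w0 a b y : 0 <= w a b y by have := d0 a y; have := d0 b y; rewrite /w; lra.
exists (fun a b => B (w a b)) => a b x.
(* A support list has no duplicates, so equal points form a single atom of mass [1]. *)
have [<-|ab] := classic (a = b).
  have fs : fs_prob (w a a) (a :: nil).
    split; first by constructor; [case | constructor].
    split=> [y ny|]; last by split=> //=; rewrite /w dE; lra.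
    by rewrite /w dN; [lra | move=> e; apply: ny; left].
  have := HB _ _ x fs; rewrite /= /w dE.
  rewrite -[fun y => _]/(w a a); set z := B _.
  have -> : (/ 2 + / 2) * rpow (d z a) q + 0
            = (rpow (d z a) q + rpow (d z a) q) / 2 by lra.
  by move=> h; apply: Rle_trans h _; lra.
have fs : fs_prob (w a b) (a :: b :: nil).
  split.
    constructor; first by case=> // e; apply: ab.
    by constructor; [case | constructor].
  split=> [y ny|].
    rewrite /w !dN; [lra | move=> e | move=> e]; apply: ny; first by right; left.
    by left.
  split=> //=; rewrite /w !dE (dN a b) ?(dN b a) //; first lra.
  by move=> e; apply: ab.
have := HB _ _ x fs; rewrite /= /w !dE (dN a b) ?(dN b a) //; last by move=> e; apply: ab.
rewrite -[fun y => _]/(w a b); set z := B _.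
have -> : (/ 2 + 0) * rpow (d z a) q + ((0 + / 2) * rpow (d z b) q + 0)
          = (rpow (d z a) q + rpow (d z b) q) / 2 by lra.
by move=> h; apply: Rle_trans h _; lra.
Qed.

(** * Coordinatewise averaging on a finite abelian group *)

Section Averaging.
Variables (X : Type) (d : X -> X -> R) (q beta : R) (mid : X -> X -> X).
Hypotheses (q_ge1 : 1 <= q) (beta_ge1 : 1 <= beta) (d_metric : is_metric d).
Hypothesis midP : forall a b x,
  rpow (d (mid a b) x) q + / rpow beta q *
    ((rpow (d (mid a b) a) q + rpow (d (mid a b) b) q) / 2)
  <= (rpow (d x a) q + rpow (d x b) q) / 2.
Variables (V : finZmodType) (n : nat) (e : nat -> V) (f : V -> X).

Let cube := {ffun 'I_n -> bool}.
Let dq x y := rpow (d x y) q.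

Let dq_ge0 x y : 0 <= dq x y. Proof. exact: rpow_ge0. Qed.
Let d_ge0 x y : 0 <= d x y. Proof. by case: d_metric. Qed.
Let dqC x y : dq x y = dq y x.
Proof. by rewrite /dq; case: d_metric => _ [_ [-> _]]. Qed.
Let d_tri x y z : d x z <= d x y + d y z.
Proof. by case: d_metric => _ [_ [_]]. Qed.
Let betaq_gt0 : 0 < rpow beta q. Proof. by apply: rpow_gt0; lra. Qed.
Let q_neq0 : q <> 0. Proof. lra. Qed.

(** The function [h_k] of the overview. Directions are indexed by [nat] so that the recursion
    carries no bound on [k]. *)
Fixpoint avg k (x : V) : X :=
  if k is k'.+1 then mid (avg k' (x + e k')%R) (avg k' (x - e k')%R) else f x.

(** The vector [t_k]. The signs below [k] stay in [s] although they do not affect the tail, so that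
    all [P_k] are sums over the same cube. *)
Definition signed_tail k (s : cube) : V :=
  (\sum_(j < n | (k <= j)%N) (if s j then e j else - e j))%R.

(** Pairs the two sign vectors differing only at [k], whose tails from [k] lead to the two points
    averaged by [mid]. *)
Definition flip (k : 'I_n) (s : cube) : cube :=
  [ffun j => if j == k then ~~ s j else s j].

Lemma flip_inj k : injective (flip k).
Proof.
apply: inv_inj => s; apply/ffunP => j; rewrite !ffunE.
by case: eqP => // _; rewrite negbK.
Qed.

Lemma signed_tailS (k : 'I_n) s :
  signed_tail k s = (signed_tail k.+1 s + (if s k then e k else - e k))%R.
Proof.
rewrite /signed_tail (bigD1 k) //= GRing.addrC; congr (_ + _)%R.
apply: eq_bigl => j; rewrite [RHS]ltn_neqAle andbC; congr andb.
by rewrite eq_sym.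
Qed.

Lemma signed_tail_flip (k : 'I_n) s :
  signed_tail k.+1 (flip k s) = signed_tail k.+1 s.
Proof.
apply: eq_bigr => j kj; rewrite ffunE; case: eqP => // jk.
by rewrite jk ltnn in kj.
Qed.

(** * Decrease of the sums [P_k], here [drift k] *)

Definition drift k : R :=
  \rsum_(s : cube) \rsum_(x : V) dq (avg k (x + signed_tail k s)%R) (f x).

Definition increment k : R := \rsum_(x : V)
  ((dq (avg k.+1 x) (avg k (x + e k)%R) + dq (avg k.+1 x) (avg k (x - e k)%R)) / 2).

Lemma increment_ge0 k : 0 <= increment k.
Proof.
apply: rsum_ge0 => x.
by have := dq_ge0 (avg k.+1 x) (avg k (x + e k)%R);
   have := dq_ge0 (avg k.+1 x) (avg k (x - e k)%R); lra.
Qed.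

Lemma drift_ge0 k : 0 <= drift k.
Proof. by apply: rsum_ge0 => s; apply: rsum_ge0. Qed.

(** For each [s] and [x], this is [midP] at the two neighbours of [x + signed_tail k.+1 s] in
    direction [e k], with test point [f x]. *)
Lemma drift_step (k : 'I_n) :
  drift k.+1 + / rpow beta q * (INR #|cube| * increment k) <= drift k.
Proof.
pose F s x := dq (avg k (x + signed_tail k s)%R) (f x).
pose I x := (dq (avg k.+1 x) (avg k (x + e k)%R)
             + dq (avg k.+1 x) (avg k (x - e k)%R)) / 2.
(* Since [flip k] is a bijection of the cube, [s] may be averaged with [flip k s]. *)
have driftE : drift k = \rsum_(s : cube) \rsum_(x : V) (/ 2 * (F s x + F (flip k s) x)).
  under eq_bigr => s _ do rewrite rsumM rsumD.
  rewrite rsumM rsumD.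
  have <- : drift k = \rsum_(s : cube) \rsum_(x : V) F (flip k s) x.
    by rewrite /drift (reindex_inj (flip_inj k)).
  by rewrite -/(drift k); lra.
rewrite driftE.
(* Translating by the tail does not change the sum over [V], so every [s] contributes one full
   [increment k]. *)
have -> : INR #|cube| * increment k
    = \rsum_(s : cube) \rsum_(x : V) I (x + signed_tail k.+1 s)%R.
  by under eq_bigr => s _ do rewrite rsum_shift; rewrite rsum_const.
rewrite -rsumM -rsumD; apply: rsum_le => s.
rewrite -rsumM -rsumD; apply: rsum_le => x.
have := midP (avg k (x + signed_tail k.+1 s + e k)%R)
             (avg k (x + signed_tail k.+1 s - e k)%R) (f x).
rewrite -!/(dq _ _) /F !(signed_tailS k) signed_tail_flip ffunE eqxx !GRing.addrA.
rewrite /I /= !(dqC (f x)).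
(* The sign at [k] only decides the order of the two neighbours. *)
case: (s k) => /= h; apply: Rle_trans h _; rewrite Rmult_comm; first exact: Rle_refl.
by rewrite Rplus_comm; exact: Rle_refl.
Qed.

(** Telescoping of [drift_step]. Discarding the increments bounds [drift k]; discarding [drift k]
    bounds the increments. *)
Lemma drift_sum k : (k <= n)%N ->
  drift k + / rpow beta q * (INR #|cube| * \rsum_(j : 'I_k) increment j) <= drift 0.
Proof.
elim: k => [_|k IH kn]; first by rewrite big_ord0; lra.
have := drift_step (Ordinal kn); have := IH (ltnW kn).
rewrite big_ord_recr /= !Rmult_plus_distr_l; lra.
Qed.

Let cube_gt0 : 0 < INR #|cube|.
Proof. by rewrite card_ffun card_bool card_ord; apply/lt_0_INR/ltP; rewrite expn_gt0. Qed.

Lemma drift_le k : (k <= n)%N -> drift k <= drift 0.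
Proof.
move=> /drift_sum.
suff : 0 <= / rpow beta q * (INR #|cube| * \rsum_(j : 'I_k) increment j) by lra.
apply: Rmult_le_pos; first exact/Rlt_le/Rinv_0_lt_compat.
apply: Rmult_le_pos; first exact: Rlt_le.
by apply: rsum_ge0 => j; apply: increment_ge0.
Qed.

(** For the standard basis [S] is [cotype_rhs]; its root [sigma] is the unit for all the norm bounds
    below. *)
Let S := drift 0 / INR #|cube|.
Let sigma := rpow S (/ q).

Let S_ge0 : 0 <= S.
Proof.
apply: Rmult_le_pos; first exact: drift_ge0.
exact/Rlt_le/Rinv_0_lt_compat.
Qed.
Let sigma_ge0 : 0 <= sigma. Proof. exact: rpow_ge0. Qed.
Let sigmaq : rpow sigma q = S. Proof. exact: rpow_root. Qed.

Lemma increment_sum : \rsum_(k : 'I_n) increment k <= rpow (beta * sigma) q.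
Proof.
rewrite rpowM ?sigmaq //; last lra.
have := drift_sum n (leqnn n); have := drift_ge0 n.
set T := \rsum_(k : 'I_n) _ => dn0 h.
have h1 : / rpow beta q * (INR #|cube| * T) <= drift 0 by lra.
have -> : T = (rpow beta q / INR #|cube|) * (/ rpow beta q * (INR #|cube| * T)).
  by field; split; lra.
have -> : rpow beta q * S = (rpow beta q / INR #|cube|) * drift 0.
  by rewrite /S; field; lra.
apply: Rmult_le_compat_l => //.
by apply/Rlt_le/Rmult_lt_0_compat => //; exact: Rinv_0_lt_compat.
Qed.

(** * Displacements under even translations *)

Definition jump r : R := \rsum_(p : 'I_n * V)
  rpow (d (avg p.1 (p.2 + e p.1 *+ r.*2)%R) (avg p.1 p.2)) q.

Lemma jump1 : jump 1 <= rpow (2 * beta * sigma) q.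
Proof.
rewrite Rmult_assoc rpowM; [|lra|by apply: Rmult_le_pos => //; lra].
apply: Rle_trans (Rmult_le_compat_l _ _ _ (rpow_ge0 2 q) increment_sum).
rewrite -rsumM /jump.
rewrite -(pair_bigA _ (fun (i : 'I_n) x => dq (avg i (x + e i *+ 2)%R) (avg i x))) /=.
(* Recentring makes the endpoints [x + e k] and [x - e k], both one increment away from
   [avg k.+1 x]. *)
apply: rsum_le => k; rewrite -(rsum_shift _ (- e k)%R) -rsumM.
apply: rsum_le => x.
rewrite GRing.mulr2n GRing.addrA GRing.subrK.
set y := avg k.+1 x; set a := avg k _; set b := avg k _.
(* The sum of the two distances is written as twice their mean, so that convexity yields exactly
   [2 ^ q] times the increment. *)
apply: (Rle_trans _ (rpow (2 * (/ 2 * d y a + (1 - / 2) * d y b)) q)).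
  apply: rpow_le => //; first lra.
  have := d_tri a y b; have -> : d a y = d y a by case: d_metric => _ [_ [-> _]].
  by lra.
have ya := d_ge0 y a; have yb := d_ge0 y b.
rewrite rpowM; [|lra|lra].
apply: Rmult_le_compat_l; first exact: rpow_ge0.
apply: Rle_trans (rpow_convex q (/ 2) _ _ q_ge1 _ ya yb) _; first lra.
by rewrite /dq; lra.
Qed.

(** Minkowski over pairs [(i, x)]: each of the [r] translations by [2 e_i] costs the same as the
    first, by translation invariance. *)
Lemma jump_le r : jump r <= rpow (INR r * (2 * beta * sigma)) q.
Proof.
have A0 : 0 <= 2 * beta * sigma by apply: Rmult_le_pos => //; lra.
elim: r => [|r IH].
  rewrite /= Rmult_0_l rpow0 /jump big1; first exact: Rle_refl.
  move=> p _; rewrite GRing.mulr0n GRing.addr0.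
  by case: d_metric => _ [/(_ (avg p.1 p.2) (avg p.1 p.2)) [_ ->]] //; rewrite rpow0.
rewrite S_INR Rmult_plus_distr_r Rmult_1_l.
pose b (p : 'I_n * V) :=
  d (avg p.1 (p.2 + e p.1 *+ r.*2 + e p.1 *+ 2)%R) (avg p.1 (p.2 + e p.1 *+ r.*2)%R).
pose a (p : 'I_n * V) := d (avg p.1 (p.2 + e p.1 *+ r.*2)%R) (avg p.1 p.2).
apply: (minkowski _ _ a b) => //.
- exact/Rmult_le_pos/A0/pos_INR.
- by move=> p; apply: d_ge0.
- by move=> p; apply: d_ge0.
- move=> p; split=> //; rewrite Rplus_comm doubleS -addn2 GRing.mulrnDr GRing.addrA.
  exact: d_tri.
apply: Rle_trans jump1; rewrite /jump /b.
rewrite -(pair_bigA _ (fun (i : 'I_n) x =>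
  dq (avg i (x + e i *+ r.*2 + e i *+ 2)%R) (avg i (x + e i *+ r.*2)%R))) /=.
rewrite -(pair_bigA _ (fun (i : 'I_n) x => dq (avg i (x + e i *+ 2)%R) (avg i x))) /=.
apply: rsum_le => i.
rewrite (rsum_shift _ (e i *+ r.*2)%R (fun x => dq (avg i (x + e i *+ 2)%R) (avg i x))).
exact: Rle_refl.
Qed.

Theorem even_translation_cotype r :
  \rsum_(i : 'I_n) \rsum_(x : V) dq (f (x + e i *+ r.*2)%R) (f x)
  <= rpow ((2 * rpow (INR n) (/ q) + beta * INR r.*2) * sigma) q.
Proof.
set L := \rsum_(i : 'I_n) _.
pose nu := rpow (INR #|cube|) (/ q).
have nu0 : 0 <= nu by exact: rpow_ge0.
have nuq : rpow nu q = INR #|cube| by apply: rpow_root => //; exact: Rlt_le.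
set C := rpow (INR n) (/ q).
have C0 : 0 <= C by exact: rpow_ge0.
have Cq : rpow C q = INR n by apply: rpow_root => //; exact: pos_INR.
(* All three legs of the path are measured in one norm over directions, signs and points; summing
   over signs brings the factor [nu], cancelled at the end. *)
pose J := ('I_n * (cube * V))%type.
have sumJ (F : 'I_n -> cube -> V -> R) :
    \rsum_(p : J) F p.1 p.2.1 p.2.2 = \rsum_(i : 'I_n) \rsum_(s : cube) \rsum_(x : V) F i s x.
  rewrite -(pair_bigA _ (fun i (u : cube * V) => F i u.1 u.2)) /=.
  by apply: eq_bigr => i _; rewrite -(pair_bigA _ (F i)).
pose t (p : J) := signed_tail p.1 p.2.1.
pose v (p : J) : V := (e p.1 *+ r.*2)%R.
pose x (p : J) := p.2.2.
pose a (p : J) := d (avg p.1 (x p + v p + t p)%R) (f (x p + v p)%R).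
pose b (p : J) := d (avg p.1 (x p + v p + t p)%R) (avg p.1 (x p + t p)%R).
pose c (p : J) := d (avg p.1 (x p + t p)%R) (f (x p)).
(* Each of the [n] directions costs at most [drift 0], which is [nu ^ q * sigma ^ q]. *)
have endq : \rsum_(p : J) rpow (c p) q <= rpow (C * (nu * sigma)) q.
  rewrite (sumJ (fun i s x => dq (avg i (x + signed_tail i s)%R) (f x))).
  apply: (Rle_trans _ (\rsum_(i : 'I_n) drift 0)).
    by apply: rsum_le => i; apply: drift_le; exact: ltnW.
  rewrite rsum_const card_ord !rpowM //; last exact: Rmult_le_pos.
  rewrite Cq nuq sigmaq /S; right; field; lra.
have startq : \rsum_(p : J) rpow (a p) q <= rpow (C * (nu * sigma)) q.
  apply: Rle_trans endq.
  rewrite (sumJ (fun i s x => dq (avg i (x + e i *+ r.*2 + signed_tail i s)%R)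
                                 (f (x + e i *+ r.*2)%R))).
  rewrite (sumJ (fun i s x => dq (avg i (x + signed_tail i s)%R) (f x))).
  apply: rsum_le => i; apply: rsum_le => s.
  rewrite (rsum_shift _ (e i *+ r.*2)%R (fun x => dq (avg i (x + signed_tail i s)%R) (f x))).
  exact: Rle_refl.
(* For fixed signs the tail is absorbed by a translation, leaving one copy of [jump r] per sign
   vector. *)
have midq : \rsum_(p : J) rpow (b p) q <= rpow (nu * (INR r * (2 * beta * sigma))) q.
  have R0 : 0 <= INR r * (2 * beta * sigma).
    by apply: Rmult_le_pos; [exact: pos_INR | apply: Rmult_le_pos => //; lra].
  rewrite rpowM // nuq.
  apply: Rle_trans (Rmult_le_compat_l _ _ _ (Rlt_le _ _ cube_gt0) (jump_le r)).
  rewrite (sumJ (fun i s x => dq (avg i (x + e i *+ r.*2 + signed_tail i s)%R)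
                                 (avg i (x + signed_tail i s)%R))).
  rewrite /jump.
  rewrite -(pair_bigA _ (fun (i : 'I_n) x => dq (avg i (x + e i *+ r.*2)%R) (avg i x))) /=.
  rewrite -rsumM; apply: rsum_le => i.
  rewrite -rsum_const; apply: rsum_le => s.
  rewrite -[X in _ <= X](rsum_shift _ (signed_tail i s)).
  by apply: rsum_le => y; rewrite GRing.addrAC; apply: Rle_refl.
have Mab : \rsum_(p : J) rpow (a p + b p) q
    <= rpow (C * (nu * sigma) + nu * (INR r * (2 * beta * sigma))) q.
  apply: (minkowski _ _ a b) => //; try by move=> p; exact: d_ge0.
  - by apply: Rmult_le_pos => //; exact: Rmult_le_pos.
  - apply: Rmult_le_pos => //; apply: Rmult_le_pos; first exact: pos_INR.
    by apply: Rmult_le_pos => //; lra.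
  - by move=> p; split; [apply: Rplus_le_le_0_compat; exact: d_ge0 | exact: Rle_refl].
have M : INR #|cube| * L <= rpow (nu * ((2 * C + beta * INR r.*2) * sigma)) q.
  (* The endpoints of the path do not depend on the signs. *)
  have -> : INR #|cube| * L
      = \rsum_(p : J) rpow (d (f (x p + v p)%R) (f (x p))) q.
    rewrite (sumJ (fun i s x => dq (f (x + e i *+ r.*2)%R) (f x))).
    by rewrite -rsumM; apply: eq_bigr => i _; rewrite rsum_const.
  have -> : nu * ((2 * C + beta * INR r.*2) * sigma)
     = C * (nu * sigma) + nu * (INR r * (2 * beta * sigma)) + C * (nu * sigma).
    by rewrite -mul2n mult_INR /=; ring.
  apply: (minkowski _ _ (fun p => a p + b p) c) => //.
  - by apply: Rplus_le_le_0_compat; apply: Rmult_le_pos => //;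
      apply: Rmult_le_pos => //; [exact: pos_INR | apply: Rmult_le_pos => //; lra].
  - by apply: Rmult_le_pos => //; exact: Rmult_le_pos.
  - by move=> p; apply: Rplus_le_le_0_compat; exact: d_ge0.
  - by move=> p; exact: d_ge0.
  move=> p; split; first exact: d_ge0.
  have h1 := d_tri (f (x p + v p)%R) (avg p.1 (x p + v p + t p)%R) (f (x p)).
  have h2 := d_tri (avg p.1 (x p + v p + t p)%R) (avg p.1 (x p + t p)%R) (f (x p)).
  have dC y z : d y z = d z y by case: d_metric => _ [_ [-> _]].
  by rewrite (dC (f (x p + v p)%R) (avg _ _)) in h1; rewrite /= Rplus_assoc;
    exact/(Rle_trans _ _ _ h1)/Rplus_le_compat_l/h2.
apply: (Rmult_le_reg_l _ _ _ cube_gt0); apply: Rle_trans M _.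
rewrite rpowM // ?nuq; first exact: Rle_refl.
apply: Rmult_le_pos => //; have := pos_INR r.*2; have := C0.
have : 0 <= beta * INR r.*2 by apply: Rmult_le_pos; [lra | exact: pos_INR].
by lra.
Qed.
End Averaging.

(** * Specialisation to the discrete torus *)

Lemma INR_exp2 k : INR (2 ^ k)%N = 2 ^ k.
Proof. by elim: k => // k IH; rewrite expnS mult_INR IH. Qed.

Lemma eps_vecE m n (s : {ffun 'I_n -> bool}) :
  eps_vec m s = (\sum_(j < n) (if s j then ebasis m j else - ebasis m j))%R.
Proof.
apply/rowP => l; rewrite mxE summxE (bigD1 l) //= big1 => [|j jl].
  by rewrite GRing.addr0; case: (s l); rewrite !mxE !eqxx.
by case: (s j); rewrite !mxE eq_sym (negbTE jl) andbF // GRing.oppr0.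
Qed.

Theorem theorem1p4 (q beta : R) (X : Type) (d : X -> X -> R) :
  1 <= q -> 1 <= beta -> is_metric d -> q_barycentric d q beta ->
  forall (n m : nat), (0 < m)%nat -> ~~ odd m ->
  forall f : 'rV['Z_(2 * m)]_n -> X,
    rpow (cotype_lhs d q f) (/ q)
      <= (4 * rpow (INR n) (/ q) + beta * INR m) * rpow (cotype_rhs d q f) (/ q)
    /\ (/ beta * rpow (INR n) (/ q) <= INR m ->
        rpow (cotype_lhs d q f) (/ q)
          <= 5 * beta * INR m * rpow (cotype_rhs d q f) (/ q)).
Proof.
move=> q1 beta1 dm /midpoint_map[mid midP] n m _ m_even f.
have q0 : q <> 0 by lra.
have Sg : 0 <= rpow (cotype_rhs d q f) (/ q) by exact: rpow_ge0.
have C0 : 0 <= rpow (INR n) (/ q) by exact: rpow_ge0.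
have m0 := pos_INR m.
have bm0 : 0 <= beta * INR m by apply: Rmult_le_pos; lra.
have main : rpow (cotype_lhs d q f) (/ q)
    <= (4 * rpow (INR n) (/ q) + beta * INR m) * rpow (cotype_rhs d q f) (/ q).
  (* The standard basis extended to all of [nat], with zero vectors from index [n] on. *)
  pose e (j : nat) : 'rV['Z_(2 * m)]_n := (\row_(l < n) (nat_of_ord l == j)%:R)%R.
  have eE (i : 'I_n) : e i = ebasis m i.
    by apply/rowP => l; rewrite !mxE eqxx.
  have tailE s : signed_tail _ n e 0 s = eps_vec m s.
    by rewrite eps_vecE; apply: eq_bigr => j _; rewrite eE.
  have := even_translation_cotype _ d q beta mid q1 beta1 dm midP _ n e f m./2.
  have -> : drift _ d q mid _ n e f 0 / INR #|{ffun 'I_n -> bool}| = cotype_rhs d q f.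
    rewrite /cotype_rhs /drift card_ffun card_bool card_ord Rmult_comm.
    congr (_ * _); last by rewrite INR_exp2.
    by apply: eq_bigr => s _; apply: eq_bigr => x _; rewrite tailE.
  (* Evenness of [m] enters here: twice [m./2] is [m]. *)
  rewrite halfK (negbTE m_even) subn0.
  have -> : \rsum_(i : 'I_n) \rsum_(x : 'rV['Z_(2 * m)]_n)
      rpow (d (f (x + e i *+ m)%R) (f x)) q = cotype_lhs d q f.
    by apply: eq_bigr => i _; apply: eq_bigr => x _; rewrite eE.
  set u := _ * _ => core.
  have u0 : 0 <= u by apply: Rmult_le_pos => //; lra.
  (* The path argument gives the coefficient [2] of [n ^ (1/q)], relaxed here to [4]. *)
  apply: (Rle_trans _ u); last by apply: Rmult_le_compat_r => //; lra.
  rewrite -(root_rpow u q q0 u0); apply: rpow_le => //.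
    by apply/Rlt_le/Rinv_0_lt_compat; lra.
  by apply: rsum_ge0 => i; apply: rsum_ge0 => x; exact: rpow_ge0.
split=> // h; apply: Rle_trans main _; apply: Rmult_le_compat_r => //.
(* The assumption on [m] amounts to [n ^ (1/q) <= beta * m], whence [4 + 1 = 5]. *)
have : beta * (/ beta * rpow (INR n) (/ q)) <= beta * INR m.
  by apply: Rmult_le_compat_l => //; lra.
rewrite -Rmult_assoc Rinv_r; lra.
Qed.
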